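(* Let $n \geq 1$ and $m\geq 1$, let $G$ be a group of order $2^n$ that is realizable in characteristic $2^m$, and let $L = \lceil \log_2(n+1)\rceil$. Then the exponent of $G$ is at most $2^{L+m-1}$.
   Context: All rings are associative and unital; $R^\times$ denotes the group of units of the ring $R$. A group $G$ is realizable in characteristic $k$ if there exists a ring $R$ of characteristic $k$ with $R^\times \cong G$. *)

(* Defs.v *)
From mathcomp Require Import all_boot all_order all_algebra all_fingroup all_solvable.

Set Implicit Arguments.
Unset Strict Implicit.
Unset Printing Implicit Defensive.

Import GRing.Theory.

Local Open Scope ring_scope.

(* Two-sided inverses in an arbitrary ring; [GRing.unit] would require a      *)
(* decidable unit predicate, i.e. a [unitRingType].                           *)
Definition invertible (R : pzRingType) (u : R) : Prop :=
  exists v : R, u * v = 1 /\ v * u = 1.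

(* [pchar R] only records prime characteristics. Here k is the nonnegative    *)
(* generator of the kernel of Z -> R, so k = 0 is characteristic zero and     *)
(* k = 1 the zero ring.                                                       *)
Definition has_characteristic (R : pzRingType) (k : nat) : Prop :=
  forall j : nat, j%:R = 0 :> R <-> (k %| j)%N.

(* The isomorphism G -> R^* is represented by its composite with the          *)
(* inclusion of R^* in R; only its values on G matter.                        *)
Definition units_isog (R : pzRingType) (gT : finGroupType) (G : {group gT}) :
    Prop :=
  exists f : gT -> R,
    [/\ {in G &, forall x y, f (x * y)%g = f x * f y},
        {in G &, injective f}
      & forall u : R, invertible u <-> exists2 x, x \in G & f x = u].

Definition realizable (gT : finGroupType) (G : {group gT}) (k : nat) : Prop :=
  exists R : pzRingType, has_characteristic R k /\ units_isog R G.

(* Main.v *)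
(** Let [g] be a unit and [y = g - 1]. Since [g ^ (2 ^ n) = 1], [y] is nilpotent;
    say [y ^ d = 0] with [d] minimal. The [2 ^ (d - 1)] elements
    [1 + b_1 y + ... + b_(d-1) y ^ (d-1)] with [b_i] in [{0, 1}] are units and
    pairwise distinct, so [d <= n + 1 <= 2 ^ L]. Hence
    [g ^ (2 ^ L) = 1 + y ^ (2 ^ L) + 2 w = 1 + 2 w], and [m - 1] further squarings
    give [1 + 2 ^ m w' = 1]. *)

Require Import Defs.
From mathcomp Require Import all_boot all_order all_algebra all_fingroup all_solvable.

Set Implicit Arguments.
Unset Strict Implicit.
Unset Printing Implicit Defensive.

Import GRing.Theory.

Section NilpotentElements.

Local Open Scope ring_scope.

Variable R : pzRingType.
Implicit Types (y z w : R) (b : bool) (s : seq bool).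

(** Induction by squaring. As [R] need not be commutative, the fact that [w] commutes with [y] is
    carried along to merge the cross terms. *)
Lemma expr_add1_pow2 y k :
  exists2 w, GRing.comm y w & (y + 1) ^+ (2 ^ k) = y ^+ (2 ^ k) + w *+ 2 + 1.
Proof.
elim: k => [|k [w yw IH]].
  by exists 0; [exact: commr0 | rewrite !expr1 mul0rn addr0].
set a := y ^+ (2 ^ k) in IH.
have aw : a * w = w * a by apply/commr_sym/commrX/commr_sym.
have ya : GRing.comm y a by apply: commrX.
(* Half of what [(a + 2w + 1)^2] adds to [a^2 + 1]: the first summand comes from [(a + 2w)^2], the
   second from [2(a + 2w)]. *)
exists (a * w + (a * w + w * w *+ 2) + (a + w *+ 2)).
  by do !(apply: commrD || apply: commrMn || apply: commrM).
have sqE : (a + w *+ 2) * (a + w *+ 2) = a * a + (a * w + (a * w + w * w *+ 2)) *+ 2.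
  move tE: (w *+ 2) => t; rewrite mulrDl !mulrDr -addrA; congr (_ + _).
  have -> : a * t = a * w *+ 2 by rewrite -tE mulrnAr.
  have -> : t * a = a * w *+ 2 by rewrite -tE mulrnAl aw.
  have -> : t * t = w * w *+ 2 *+ 2 by rewrite -tE mulrnAr mulrnAl.
  by rewrite -!mulrnDl.
by rewrite expnSr !exprM IH -/a sqrrD1 !expr2 sqE -[X in X + 1]addrA -mulrnDl.
Qed.

Lemma expr_add1_mul2_pow2 z k :
  exists w, (z *+ 2 + 1) ^+ (2 ^ k) = w *+ (2 ^ k.+1) + 1.
Proof.
elim: k => [|k [w IH]]; first by exists z; rewrite expn0 expr1 expn1.
(* [(2^(k+1) w)^2 = 2^(k+2) (2^k w^2)], and the cross term is [2^(k+2) w]. *)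
exists (w ^+ 2 *+ 2 ^ k + w); rewrite expnSr exprM IH sqrrD1; congr (_ + 1).
rewrite exprMn_n mulrnDl -!mulrnA -expnSr -expnM -expnD.
by rewrite muln2 -addnn addSnnS.
Qed.

(** The inverse is the finite geometric series in [- z]; it commutes with [1 + z], so one side
    suffices. *)
Lemma nilpotent_add1_invertible z k : z ^+ k = 0 -> invertible (1 + z).
Proof.
move=> zk0; have nz : (- z) ^+ k = 0 by rewrite exprNn zk0 mulr0.
have sE : (1 + z) * (\sum_(i < k) (- z) ^+ i) = 1.
  by have := subrX1 (- z) k; rewrite nz sub0r -opprD mulNr addrC => /oppr_inj.
exists (\sum_(i < k) (- z) ^+ i); split=> //.
rewrite -[RHS]sE; apply/commr_sym/commr_sum => i _; apply: commrX.
by apply: commrN; apply: commr_sym; apply: commrD; [exact: commr1 |].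
Qed.

(** Horner form of a polynomial in [y] with coefficients 0 and 1, constant term first. *)
Definition bitpoly y s : R := foldr (fun b v => b%:R + y * v) 0 s.

Lemma bitpoly_comm y s : GRing.comm y (bitpoly y s).
Proof.
elim: s => [|b s IH] /=; first exact: commr0.
by apply: commrD; [exact: commr_nat | apply: commrM].
Qed.

Lemma bitpoly_true_invertible y d s :
  y ^+ d = 0 -> invertible (bitpoly y (true :: s)).
Proof.
move=> yd0; apply: (@nilpotent_add1_invertible _ d).
by rewrite exprMn_comm ?yd0 ?mul0r //; exact: bitpoly_comm.
Qed.

(* Multiplying by [y ^ (d - i)] kills every term of [y ^ i * bitpoly y s] except
   the lowest one, so the head of [s] can be read off. *)
Lemma bitpoly_inj y d i s s' : y ^+ d != 0 -> y ^+ d.+1 = 0 ->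
  size s = size s' -> (i + size s <= d.+1)%N ->
  y ^+ i * bitpoly y s = y ^+ i * bitpoly y s' -> s = s'.
Proof.
move=> yd yd1; elim: s s' i => [|b s IH] [|b' s'] //= i [ss'] le_id E.
have le_i : (i <= d)%N.
  by rewrite -ltnS (leq_trans _ le_id) // addnS ltnS leq_addr.
have low c v : y ^+ (d - i) * (y ^+ i * (c%:R + y * v)) = y ^+ d *+ c.
  by rewrite mulrA -exprD subnK // mulrDr mulrA -exprSr yd1 mul0r addr0 mulr_natr.
have bb' : b = b'.
  have := congr1 ( *%R (y ^+ (d - i))) E; rewrite !low.
  by case: (b) (b') => [] [] // /eqP; rewrite ?(eq_sym 0) (negPf yd).
(* The nilpotent [y] cannot be cancelled, so the tails are compared with the larger factor
   [y ^+ i.+1]. *)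
rewrite -bb' in E *; congr (_ :: _); apply: (IH _ i.+1) => //.
  by rewrite addSnnS.
by move: E; rewrite !mulrDr !mulrA -exprSr => /addrI.
Qed.

Lemma nilpotent_index_le (N : nat) y (us : seq R) :
    (forall u : R, invertible u -> u \in us) -> (size us <= 2 ^ N)%N ->
  (exists k, y ^+ k = 0) -> y ^+ N.+1 = 0.
Proof.
move=> us_units us_le [k yk0].
have ex : exists k, y ^+ k == 0 by exists k; apply/eqP.
case: (ex_minnP ex) => -[|d] /eqP yd0 dmin.
  (* Least exponent 0 means [1 = 0], so every element vanishes. *)
  by rewrite -[LHS]mul1r -(expr0 y) yd0 mul0r.
have yd : y ^+ d != 0 by apply/negP => /dmin; rewrite ltnn.
suff: (2 ^ d <= 2 ^ N)%N.
  rewrite leq_exp2l // => dN.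
  by rewrite -(subnK (dN : (d.+1 <= N.+1)%N)) exprD yd0 mulr0.
apply: leq_trans us_le; rewrite -card_bool -card_tuple cardE.
rewrite -(size_map (fun t : d.-tuple bool => bitpoly y (true :: t))).
apply: uniq_leq_size; last first.
  by move=> _ /mapP[t _ ->]; apply/us_units/(bitpoly_true_invertible t yd0).
rewrite map_inj_uniq ?enum_uniq // => t t' E; apply: val_inj.
suff [] : true :: t = true :: t' by [].
by apply: (bitpoly_inj (i := 0) yd yd0); rewrite ?E //= ?size_tuple.
Qed.

Lemma expr_unit_pow2 (N m : nat) (g : R) (us : seq R) :
    (0 < m)%N -> (2 ^ m)%:R = 0 :> R ->
    (forall u : R, invertible u -> u \in us) -> (size us <= 2 ^ N)%N ->
    g ^+ (2 ^ N) = 1 ->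
  g ^+ (2 ^ (up_log 2 (N + 1) + m - 1)) = 1.
Proof.
move=> m_gt0 char2m us_units us_le gN; set L := up_log _ _.
have gE : g = (g - 1) + 1 by rewrite subrK.
(* From [g ^+ (2 ^ N) = 1], the power [(g - 1) ^+ (2 ^ N)] is twice an element, so its [m]-th power
   is a multiple of [2 ^ m]. *)
have nil : exists k, (g - 1) ^+ k = 0.
  have [w _] := expr_add1_pow2 (g - 1) N; rewrite -gE gN => E.
  exists (2 ^ N * m)%N; rewrite exprM.
  have /eqP -> : (g - 1) ^+ (2 ^ N) == - w *+ 2.
    rewrite mulNrn -addr_eq0; apply/eqP/(addIr 1).
    by rewrite -E add0r.
  by rewrite exprMn_n -mulr_natr char2m mulr0.
have yL : (g - 1) ^+ (2 ^ L) = 0.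
  have leL : (N.+1 <= 2 ^ L)%N by rewrite -addn1 up_logP.
  by rewrite -(subnK leL) exprD (nilpotent_index_le us_units us_le nil) mulr0.
have [w _] := expr_add1_pow2 (g - 1) L; rewrite -gE yL add0r => gL.
rewrite -addnBA // expnD exprM gL.
have [v ->] := expr_add1_mul2_pow2 w (m - 1).
by rewrite subn1 prednK // -mulr_natr char2m mulr0 add0r.
Qed.

End NilpotentElements.

Theorem theorem1p3 (n m : nat) (gT : finGroupType) (G : {group gT}) :
  1 <= n -> 1 <= m -> #|G| = 2 ^ n -> realizable G (2 ^ m) ->
  exponent G <= 2 ^ (up_log 2 (n + 1) + m - 1).
Proof.
move=> _ m_gt0 oG [R [charR [f [fM f_inj fU]]]].
(* [f 1] is idempotent and invertible, hence 1. *)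
have f1 : f 1%g = 1%R.
  have /fU[v [fv _]] : exists2 x, x \in G & f x = f 1%g by exists 1%g.
  by rewrite -fv -[in RHS](mulg1 1%g) fM // -mulrA fv mulr1.
have fX x k : x \in G -> f (x ^+ k)%g = (f x ^+ k)%R.
  move=> Gx; elim: k => [|k IH]; first by rewrite expg0 expr0.
  by rewrite expgS exprS fM ?groupX // IH.
apply: dvdn_leq; first by rewrite expn_gt0.
apply/exponentP => x Gx; apply: f_inj; rewrite ?groupX // fX // f1.
apply: (@expr_unit_pow2 R n m _ [seq f z | z <- enum G]) => //.
- exact/charR.
- by move=> u /fU[z Gz <-]; apply: map_f; rewrite mem_enum.
- by rewrite size_map -cardE oG.
- by rewrite -fX // -oG expg_cardG.
Qed.
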